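(* Let $S_m\times S_n$ act on $\mathbb R^{m\times n}$ by $((\pi,\tau)\cdot A)_{i,j}=A_{\pi^{-1}(i),\tau^{-1}(j)}$. For each fixed $m\geq3$, $$\liminf_{n\to\infty}c_2\big(\mathbb R^{m\times n}/(S_m\times S_n)\big)=\infty.$$
   Context: $S_k$ is the symmetric group on $\{1,\ldots,k\}$, and $\mathbb R^{m\times n}$ carries the Frobenius norm. If a group $G$ acts by isometries on a metric space $X$ with closed orbits, the orbit space $X/G$ carries the quotient metric $d([x],[y])=\inf_{p\in[x],\,q\in[y]}d_X(p,q)$, where $[x]=G\cdot x$. For a map $f\colon X\to Y$ of metric spaces, let $\alpha,\beta\in[0,\infty]$ be the largest and smallest constants (respectively) with $\alpha\, d_X(x,x')\le d_Y(f(x),f(x'))\le\beta\, d_X(x,x')$ for all $x,x'\in X$; the distortion of $f$ is $\kappa(f):=\beta/\alpha$, with $\kappa(f)=\infty$ if $\alpha=0$ or $\beta=\infty$. The Euclidean distortion $c_2(X)\in[1,\infty]$ is the infimum of all $c$ for which there exist a Hilbert space $H$ and a map $f\colon X\to H$ with $\kappa(f)=c$. *)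

(* Defs.v *)
From HB Require Import structures.
From mathcomp Require Import all_boot all_order all_algebra all_fingroup.
From mathcomp Require Import sesquilinear.
From mathcomp Require Import all_classical all_reals all_analysis.

Set Implicit Arguments.
Unset Strict Implicit.
Unset Printing Implicit Defensive.

Import Order.TTheory GRing.Theory Num.Theory.
Import numFieldNormedType.Exports.

Local Open Scope classical_set_scope.
Local Open Scope ring_scope.

(* Real scalars are enough: a complex Hilbert space is a real one, with the
   same norm, for the real part of its inner product. *)
Record hilbertSpace (R : realType) : Type := HilbertSpace {
  hilbert_sort :> completeNormedModType R ;
  inner : {dot hilbert_sort for idfun} ;
  inner_norm : forall x : hilbert_sort, inner x x = `|x| ^+ 2 }.

Section Distortion.
Context (R : realType) (X Y : Type) (dX : X -> X -> R) (dY : Y -> Y -> R).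
Variable f : X -> Y.
Local Open Scope ereal_scope.

(* Products in [\bar R] satisfy +oo * 0 = 0, so a constant +oo imposes
   nothing on pairs of points at distance 0. *)
Definition lower_lipschitz : \bar R :=
  ereal_sup [set a | 0 <= a /\
    forall x x', a * (dX x x')%:E <= (dY (f x) (f x'))%:E].

Definition upper_lipschitz : \bar R :=
  ereal_inf [set b | 0 <= b /\
    forall x x', (dY (f x) (f x'))%:E <= b * (dX x x')%:E].

Definition distortion : \bar R :=
  if (lower_lipschitz == 0) || (upper_lipschitz == +oo) then +oo
  else upper_lipschitz / lower_lipschitz.

End Distortion.

Definition norm_dist (R : realType) (V : normedModType R) (u v : V) : R :=
  `|u - v|.

Definition euclidean_distortion (R : realType) (X : Type)
    (dX : X -> X -> R) : \bar R :=
  ereal_inf [set c | exists (H : hilbertSpace R) (f : X -> H),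
    distortion dX (@norm_dist R H) f = c].

Section OrbitSpace.
Context (R : realType) (G : finGroupType) (X : Type).
Variables (dX : X -> X -> R) (to : {action G &-> X}).

Definition action_orbit (x : X) : set X := range (to x).

(* The points of the orbit space are the orbits themselves. *)
Definition orbit_space : Type := set_type (range action_orbit).

Definition orbit_dist (o o' : orbit_space) : R :=
  inf [set dX p q | p in val o & q in val o'].

End OrbitSpace.

Arguments orbit_dist {R G X} dX to o o'.

Section MatrixRowColumn.
Context (R : realType) (m n : nat).

(* The norm that the library puts on ['M[R]_(m, n)] is the max norm, so the
   Frobenius norm is defined separately. *)
Definition frobenius_norm (A : 'M[R]_(m, n)) : R :=
  Num.sqrt (\sum_i \sum_j A i j ^+ 2).

Definition frobenius_dist (A B : 'M[R]_(m, n)) : R := frobenius_norm (A - B).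

Definition rowcol_act (A : 'M[R]_(m, n)) (s : 'S_m * 'S_n) : 'M[R]_(m, n) :=
  \matrix_(i, j) A ((s.1)^-1%g i) ((s.2)^-1%g j).

(* The library's actions are right actions, and its product of permutations
   composes from left to right: [(s * t) x = t (s x)]. The two conventions
   cancel out, so the formula is the usual one for a left action. *)
Lemma rowcol_act1 A : rowcol_act A 1%g = A.
Proof. by apply/matrixP => i j; rewrite mxE /= !invg1 !perm1. Qed.

Lemma rowcol_actM A : act_morph rowcol_act A.
Proof.
by move=> s t; apply/matrixP => i j; rewrite !mxE /= !invMg !permM.
Qed.

Definition rowcol_action : {action ('S_m * 'S_n)%type &-> 'M[R]_(m, n)} :=
  TotalAction rowcol_act1 rowcol_actM.

End MatrixRowColumn.

(* Main.v *)
(* The columns of a matrix form a configuration of n points of R^m, and S_n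
   matches two configurations at the least quadratic cost, so the orbit space
   contains, up to bounded sets on which S_m is frozen by shifting the rows far
   apart, quadratic Wasserstein spaces of R^3. Fix a finite set T of points and
   let p_s be the configuration made of T and of one more copy of s in T. The
   squared distance of p_s and p_t is the least cost of a path from s to t in T
   for the cost |u - v|^2 of a step: shifting the masses along a path gives the
   upper bound, and a potential bounded by the squared distance gives the lower
   one. As subdividing an edge makes it cheap, the square root of any
   graph metric can be realised in this way (Andoni, Naor and Neiman).

   The graph used here is the bilinear forms graph over F_2: a x a matrices, with
   X and Y adjacent when rank (X - Y) <= 1. The eigenvalues of the random walk
   X -> X + u v on the nontrivial characters (-1)^tr(B X) are at most 1/2, which
   gives a Poincare inequality for Hilbert-valued maps with a constant that does
   not depend on a, although X and X + 1 are at distance a. So the square of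
   the distortion is at least a constant times a. *)
Require Import Defs.
From HB Require Import structures.
From mathcomp Require Import all_boot all_order all_algebra all_fingroup.
From mathcomp Require Import all_classical all_reals all_analysis.
From mathcomp Require Import sesquilinear zify ring lra.

Set Implicit Arguments.
Unset Strict Implicit.
Unset Printing Implicit Defensive.

Import Order.TTheory GRing.Theory Num.Theory.
Import numFieldNormedType.Exports.

Local Open Scope ring_scope.

(** * The spectral gap of the bilinear forms graph *)

Section Fourier.
Context (R : realType) (a : nat).
Local Notation V := 'M['F_2]_a.

Definition sgnF2 (x : 'F_2) : R := (-1) ^+ (x : nat).

Lemma F2_cases (x : 'F_2) : x = 0 \/ x = 1.
Proof.
by case: x => [[|[|[]]]] // hx; [left|right]; apply/val_inj.
Qed.

Lemma F2_addxx (x : 'F_2) : x + x = 0.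
Proof. by case: (F2_cases x) => ->; apply/val_inj. Qed.

Lemma sgnF2D x y : sgnF2 (x + y) = sgnF2 x * sgnF2 y.
Proof.
by case: (F2_cases x) => ->; case: (F2_cases y) => ->;
  rewrite /sgnF2 /= ?expr0 ?expr1 ?mulrNN ?mulr1 ?mul1r.
Qed.

Lemma sgnF2_sqr x : sgnF2 x * sgnF2 x = 1.
Proof. by rewrite -expr2 sqrr_sign. Qed.

Lemma sgnF2E x : sgnF2 x = 1 - 2 * (x != 0)%:R.
Proof.
case: (F2_cases x) => ->; rewrite /sgnF2 ?eqxx ?oner_eq0 /= ?expr0 ?expr1; ring.
Qed.

Definition chi (B X : V) : R := sgnF2 (\tr (B *m X)).

Lemma chiDr B X Y : chi B (X + Y) = chi B X * chi B Y.
Proof. by rewrite /chi mulmxDr mxtraceD sgnF2D. Qed.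

Lemma chiDl B C X : chi (B + C) X = chi B X * chi C X.
Proof. by rewrite /chi mulmxDl mxtraceD sgnF2D. Qed.

Lemma tr_delta (X : V) i j : \tr (delta_mx i j *m X) = X j i.
Proof.
rewrite /mxtrace (bigD1 i) //= big1 ?addr0 => [|k ki]; last first.
  rewrite mxE big1 // => l _; rewrite mxE (negbTE ki) /= mul0r //.
rewrite mxE (bigD1 j) //= big1 ?addr0 => [|k kj]; last first.
  by rewrite mxE (negbTE kj) andbF mul0r.
by rewrite mxE !eqxx mul1r.
Qed.

(** Translating [B] by the matrix unit that reads off a nonzero entry of [X] flips every sign, so
    the sum equals its own negative. *)
Lemma chi_sum (X : V) : \sum_B chi B X = #|{: V}|%:R *+ (X == 0).
Proof.
case: eqVneq => [->|/matrix0Pn[j [i Xji]]].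
  rewrite (eq_bigr (fun=> 1)) => [|B _]; last by rewrite /chi mulmx0 mxtrace0.
  by rewrite sumr_const.
suff : \sum_B chi B X = - \sum_B chi B X by move=> /= h; lra.
rewrite {1}(reindex_inj (addrI (delta_mx i j))) /= -sumrN; apply: eq_bigr => B _.
rewrite chiDl {1}/chi tr_delta sgnF2E Xji /=; ring.
Qed.

Section Hilbert.
Variable H : hilbertSpace R.
Local Notation dot := (inner H).

Lemma dot_sum2 (I : finType) (u w : I -> H) :
  dot (\sum_i u i) (\sum_i w i) = \sum_i \sum_j dot (u i) (w j).
Proof.
rewrite linear_sumlz; apply: eq_bigr => i _; exact: linear_sumr.
Qed.

Lemma parseval (h : V -> H) :
  \sum_B `|\sum_X chi B X *: h X| ^+ 2 = #|{: V}|%:R * \sum_X `|h X| ^+ 2.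
Proof.
under eq_bigr do rewrite -inner_norm dot_sum2.
rewrite exchange_big /= mulr_sumr; apply: eq_bigr => X _.
rewrite exchange_big /= (bigD1 X) //= [X in _ + X]big1 ?addr0 => [|Y YX].
  under eq_bigr do rewrite linearZl_LR linearZr_LR /= mulrA sgnF2_sqr mul1r.
  by rewrite sumr_const inner_norm mulr_natl.
under eq_bigr do rewrite linearZl_LR linearZr_LR /= mulrA -chiDr.
rewrite -mulr_suml chi_sum.
have F2opp (Z : V) : Z = - Z.
  by apply/eqP; rewrite -addr_eq0; apply/eqP/matrixP => i j; rewrite !mxE F2_addxx.
by rewrite [X in X == 0 :> V](_ : X + Y = X - Y) ?subr_eq0 1?eq_sym ?(negbTE YX) ?mul0r // -F2opp.
Qed.

(** Translation by [W] multiplies the Fourier coefficient at [B] by [chi B W]; the factor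
    [chi B W - 1] is 0 or -2. *)
Lemma parseval_shift (f : V -> H) W :
  #|{: V}|%:R * \sum_X `|f (X + W) - f X| ^+ 2 =
  \sum_B 4 * (\tr (B *m W) != 0)%:R * `|\sum_X chi B X *: f X| ^+ 2.
Proof.
rewrite -(parseval (fun X => f (X + W) - f X)); apply: eq_bigr => B _.
have -> : \sum_X chi B X *: (f (X + W) - f X) =
          (chi B W - 1) *: \sum_X chi B X *: f X.
  under eq_bigr do rewrite scalerBr.
  rewrite sumrB scalerBl scale1r; congr (_ - _).
  rewrite scaler_sumr [RHS](reindex_inj (addIr W)) /=; apply: eq_bigr => X _.
  by rewrite chiDr scalerA mulrCA sgnF2_sqr mulr1.
rewrite normrZ exprMn; congr (_ * _).
rewrite real_normK ?num_real // /chi sgnF2E; case: (_ == 0) => /=; ring.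
Qed.

(* Of the four values of [b] obtained by adding [u0] or not to [u] and [w0] or
   not to [w], an odd number is nonzero. *)
Lemma biadditive_count (U W : finZmodType) (b : U -> W -> 'F_2) u0 w0 :
  (forall u u' w, b (u + u') w = b u w + b u' w) ->
  (forall u w w', b u (w + w') = b u w + b u w') -> b u0 w0 != 0 ->
  (#|U| * #|W|)%:R <= 4 * \sum_u \sum_w (b u w != 0)%:R :> R.
Proof.
move=> bDl bDr b0.
pose c u w : R := (b u w != 0)%:R.
have shu (F : U -> R) : \sum_u F (u + u0) = \sum_u F u.
  by rewrite [RHS](reindex_inj (addIr u0)).
have shw (F : W -> R) : \sum_w F (w + w0) = \sum_w F w.
  by rewrite [RHS](reindex_inj (addIr w0)).
have -> : (#|U| * #|W|)%:R = \sum_(u : U) \sum_(w : W) 1 :> R.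
  by rewrite !sumr_const -mulrnA mulnC.
have -> : 4 * \sum_u \sum_w (b u w != 0)%:R =
   \sum_u \sum_w (c u w + c (u + u0) w + c u (w + w0) + c (u + u0) (w + w0)).
  under [RHS]eq_bigr => u _.
    rewrite !big_split /= (shw (c u)) (shw (c (u + u0))); over.
  rewrite !big_split /= (shu (fun u => \sum_w c u w)); rewrite /c; ring.
apply: ler_sum => u _; apply: ler_sum => w _.
have : [|| b u w != 0, b (u + u0) w != 0, b u (w + w0) != 0
         | b (u + u0) (w + w0) != 0].
  apply: contraNT b0; rewrite !negb_or !negbK.
  rewrite !(bDl, bDr) => /and4P[/eqP -> ].
  rewrite !add0r => /eqP -> /eqP ->.
  by rewrite !add0r.
rewrite /c; case: (b u w != 0); case: (b (u + u0) w != 0);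
  case: (b u (w + w0) != 0); case: (b (u + u0) (w + w0) != 0) => //= _; lra.
Qed.

(** The spectral gap: at least a quarter of the steps [u *m v] flip the sign of a nontrivial
    character, so its eigenvalue is at most 1 - 2/4. *)
Lemma bilin_count (B : V) : B != 0 ->
  (#|{: 'cV['F_2]_a}| * #|{: 'rV['F_2]_a}|)%:R <=
    4 * \sum_(u : 'cV['F_2]_a) \sum_(v : 'rV['F_2]_a)
          (\tr (B *m (u *m v)) != 0)%:R :> R.
Proof.
case/matrix0Pn=> j [i Bji].
apply: (biadditive_count (u0 := delta_mx i 0) (w0 := delta_mx 0 j)
  (b := fun u v => \tr (B *m (u *m v)))).
- by move=> u u' w; rewrite mulmxDl mulmxDr mxtraceD.
- by move=> u w w'; rewrite !mulmxDr mxtraceD.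
- by rewrite mul_delta_mx mxtrace_mulC tr_delta.
Qed.

Lemma poincare (f : V -> H) (c : R) (W : V) :
  (forall X Y : V, (\rank (Y - X)%R <= 1)%N -> `|f Y - f X| ^+ 2 <= c) ->
  \sum_X `|f (X + W) - f X| ^+ 2 <= 4 * (#|{: V}|%:R * c).
Proof.
move=> hf.
pose N : R := #|{: V}|%:R; pose M : R := (#|{: 'cV['F_2]_a}| * #|{: 'rV['F_2]_a}|)%:R.
pose F B := `|\sum_X chi B X *: f X| ^+ 2.
have F0 B : 0 <= F B by exact: exprn_ge0.
have N0 : 0 < N by rewrite ltr0n; apply/card_gt0P; exists 0.
have M0 : 0 < M.
  by rewrite ltr0n muln_gt0; apply/andP; split; apply/card_gt0P; exists 0.
have up : \sum_(u : 'cV['F_2]_a) \sum_(v : 'rV['F_2]_a)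
   (\sum_X `|f (X + u *m v) - f X| ^+ 2) <= M * (N * c).
  rewrite /M natrM -mulrA mulr_natl -sumr_const; apply: ler_sum => u _.
  rewrite mulr_natl -sumr_const; apply: ler_sum => v _.
  rewrite mulr_natl -sumr_const; apply: ler_sum => X _.
  apply: hf; rewrite addrC addKr (leq_trans (mxrankM_maxr _ _)) //; exact: rank_leq_row.
rewrite -(ler_pM2l (mulr_gt0 M0 N0)) -mulrA parseval_shift.
(* The comparison is made one character at a time: the weight of [F B] is at most 4 for the shift by
   [W], at least 1 on average over the rank-one shifts if [B != 0], and 0 on both sides if
   [B = 0]. *)
have lo : M * (\sum_B 4 * (\tr (B *m W) != 0)%:R * F B) <=
   4 * \sum_(u : 'cV['F_2]_a) \sum_(v : 'rV['F_2]_a)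
   (N * \sum_X `|f (X + u *m v) - f X| ^+ 2).
  under [X in _ <= _ * X]eq_bigr => u _.
    under eq_bigr do rewrite parseval_shift.
    rewrite exchange_big /=; over.
  rewrite exchange_big /= !mulr_sumr; apply: ler_sum => B _.
  under eq_bigr => u _ do rewrite -mulr_suml -mulr_sumr.
  rewrite -mulr_suml -mulr_sumr -/(F B); move: (F B) (F0 B) => t t0.
  rewrite !mulrA; apply: ler_wpM2r => //.
  have [->|B0] := eqVneq B 0.
    rewrite mul0mx mxtrace0 eqxx mulr0 !mulr_ge0 //.
    by apply: sumr_ge0 => u _; apply: sumr_ge0.
  have := bilin_count B0; rewrite -/M.
  case: (_ != 0); rewrite ?mulr1 ?mulr0; nra.
apply: (le_trans lo).
under eq_bigr do rewrite -mulr_sumr.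
rewrite -mulr_sumr; nra.
Qed.

End Hilbert.
End Fourier.

Definition sqdist (p q : seq int) : int := \sum_(i < 3) (p`_i - q`_i) ^+ 2.

(** * A drawing of a graph in space *)

Section Sites.
Context (V : finType) (adj : rel V) (M L : nat).

(* A drawing in space of the bipartite double cover of the graph [adj], each
   pair of adjacent vertices being joined by equally many unit steps. A vertex
   becomes a segment at height 0 parallel to the second axis, its copy becomes
   a segment at height [L] parallel to the first axis, and adjacent [x] and [y]
   are joined by a vertical segment. The vertical segment of a non-adjacent
   pair is collapsed to its foot. *)
Definition site : Type := (V * 'I_L.+1 + V * 'I_L.+1 + V * V * 'I_L.+1)%type.
HB.instance Definition _ := Finite.on site.

Definition rk (x : V) : int := (M * enum_rank x)%:Z.
Arguments rk : simpl never.

Definition pos (s : site) : seq int :=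
  match s with
  | inl (inl (x, t)) => [:: rk x; t%:Z; 0]
  | inl (inr (y, t)) => [:: t%:Z; rk y; L%:Z]
  | inr (x, y, t) => [:: rk x; rk y; if adj x y then t%:Z else 0]
  end.

Definition cost (s t : site) : int := sqdist (pos s) (pos t).

Lemma costE s t : cost s t = ((pos s)`_0 - (pos t)`_0) ^+ 2 +
  ((pos s)`_1 - (pos t)`_1) ^+ 2 + ((pos s)`_2 - (pos t)`_2) ^+ 2.
Proof. by rewrite /cost /sqdist !big_ord_recl big_ord0 addr0 /= addrA. Qed.

Lemma cost_sym s t : cost s t = cost t s.
Proof. by rewrite !costE; congr (_ + _ + _); rewrite -sqrrN opprB. Qed.

Lemma pos_bounds s i : (M * #|V| <= L)%N -> 0 <= (pos s)`_i <= L%:Z.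
Proof.
move=> ML; have rkL x : rk x <= L%:Z.
  by rewrite /rk lez_nat (leq_trans _ ML)// leq_mul2l ltnW ?orbT.
have tL (t : 'I_L.+1) : t%:Z <= L%:Z by rewrite lez_nat -ltnS.
case: s => [[[x t]|[y t]]|[[x y] t]]; case: i => [|[|[|i]]] //;
  rewrite /pos /= ?nth_nil // ?rkL ?tL //.
by rewrite (fun_if (fun z : int => 0 <= z <= L%:Z)) /= tL; case: ifP.
Qed.

Section Potential.
Variables (a : nat) (d : V -> nat).
Hypotheses (da : forall x, (d x <= a)%N)
  (dadj : forall x y, adj x y -> (d x <= (d y).+1)%N && (d y <= (d x).+1)%N)
  (aL : (a * L <= M * M)%N) (aL' : (a <= L)%N).

(* It interpolates [L * d] linearly along the vertical segments; being at most
   the squared distance, its variation bounds transport costs from below. *)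
Definition potential (s : site) : int :=
  match s with
  | inl (inl (x, _)) => L%:Z * (d x)%:Z
  | inl (inr (y, _)) => L%:Z * (d y)%:Z
  | inr (x, y, t) => L%:Z * (d x)%:Z +
      if adj x y then ((d y)%:Z - (d x)%:Z) * t%:Z else 0
  end.

Lemma potential_bounds s : 0 <= potential s <= a%:Z * L%:Z.
Proof.
case: s => [[[x t]|[y t]]|[[x y] t]] /=; try by have := da x; nia.
  by have := da y; nia.
have := da x; have := da y; have := ltn_ord t.
case: ifP => [/dadj|_]; rewrite ?addr0; nia.
Qed.

(** The ranks are spaced by [M], so sites over different vertices are separated by more than the
    whole range of the potential can detect. *)
Lemma rk_far x y : x != y -> a%:Z * L%:Z <= (rk x - rk y) ^+ 2.
Proof.
move=> xy; rewrite /rk.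
have : enum_rank x != enum_rank y :> nat.
  by apply: contra_neq xy => /ord_inj/enum_rank_inj.
move: aL; move: (enum_rank x : nat) (enum_rank y : nat) => i j aLM ij.
rewrite !PoszM -mulrBr exprMn.
have : 1 <= (i%:Z - j%:Z) ^+ 2 by nia.
nia.
Qed.

(** Sites over different vertices, or at heights 0 and [L], are far enough apart for the crude bound
    [a * L]. Along a vertical segment the slope is at most 1 in absolute value. *)
Lemma potential_le s t : potential t - potential s <= cost s t.
Proof.
have bs := potential_bounds s; have bt := potential_bounds t.
have far : a%:Z * L%:Z <= cost s t -> potential t - potential s <= cost s t by lia.
have sq (z : int) : 0 <= z ^+ 2 by exact: sqr_ge0.
have sq1 (z : nat) : z%:Z <= z%:Z ^+ 2 by nia.
have sqL : a%:Z * L%:Z <= L%:Z ^+ 2 by nia.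
have cx : a%:Z * L%:Z <= ((pos s)`_0 - (pos t)`_0) ^+ 2 -> a%:Z * L%:Z <= cost s t.
  rewrite costE; have := sq ((pos s)`_1 - (pos t)`_1); have := sq ((pos s)`_2 - (pos t)`_2).
  lia.
have cy : a%:Z * L%:Z <= ((pos s)`_1 - (pos t)`_1) ^+ 2 -> a%:Z * L%:Z <= cost s t.
  rewrite costE; have := sq ((pos s)`_0 - (pos t)`_0); have := sq ((pos s)`_2 - (pos t)`_2).
  lia.
have cz : ((pos s)`_2 - (pos t)`_2) ^+ 2 <= cost s t.
  rewrite costE; have := sq ((pos s)`_0 - (pos t)`_0); have := sq ((pos s)`_1 - (pos t)`_1).
  lia.
have c0 : 0 <= cost s t := le_trans (sq _) cz.
have slope x y : adj x y -> -1 <= (d y)%:Z - (d x)%:Z <= 1 by move=> /dadj; lia.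
(* Integrality of [u] is what lets a linear term be dominated by a square. *)
have absq (z u : int) : -1 <= z <= 1 -> z * u <= u ^+ 2.
  move=> z1; have [u0|u0] : u <= -1 \/ 0 <= u by lia.
    have : z * u <= (-1) * u by rewrite ler_wnM2r; lia.
    have : (-1) * u <= u * u by rewrite ler_wnM2r; lia.
    by rewrite expr2; lia.
  have [->|u1] : u = 0 \/ 1 <= u by lia.
    by rewrite mulr0.
  have : z * u <= 1 * u by rewrite ler_wpM2r; lia.
  have : 1 * u <= u * u by rewrite ler_wpM2r; lia.
  by rewrite expr2; lia.
case: s bs far cx cy cz c0 => [[[x u]|[y u]]|[[x y] u]] bs far cx cy cz c0;
case: t bt far cx cy cz c0 => [[[x' u']|[y' u']]|[[x' y'] u']] bt far cx cy cz c0;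
move: bs bt far cx cy cz c0; rewrite /=;
try (have [<-|/rk_far xx] := eqVneq x x'; last by move=> *; auto);
try (have [<-|/rk_far yy] := eqVneq y y'; last by move=> *; auto);
move=> _ _ far _ _ cz c0.
- by rewrite subrr.
- by apply: far; apply: le_trans cz; rewrite sub0r sqrrN.
- case: ifP cz => [/slope h|_] /= cz; last by rewrite addr0 subrr.
  by have := absq _ u' h; lia.
- by apply: far; apply: le_trans cz; rewrite subr0.
- by rewrite subrr.
- case: ifP cz far => [/slope h|_] /= cz far; last first.
    by apply: far; apply: le_trans cz; rewrite subr0.
  by have := absq ((d x')%:Z - (d y)%:Z) (L%:Z - u'%:Z); lia.
- case: ifP cz => [/slope h|_] /= cz; last by rewrite addr0 subrr.
  by have := absq ((d x)%:Z - (d y)%:Z) u; lia.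
- case: ifP cz far => [/slope h|_] /= cz far; last first.
    by apply: far; apply: le_trans cz; rewrite sub0r sqrrN.
  by have := absq _ (u%:Z - L%:Z); have := absq _ (L%:Z - u%:Z) h; lia.
- case: ifP cz => [/slope h|_] /= cz; last by rewrite subrr.
  by have := absq _ (u'%:Z - u%:Z) h; lia.
Qed.
End Potential.

(* Sites joined by a chain of at most [k] steps of length at most one. *)
Definition chain (k : nat) (s t : site) : Prop :=
  exists p, [/\ path (fun s t => cost s t <= 1) s p, last s p = t & (size p <= k)%N].

Lemma chain_step s t : cost s t <= 1 -> chain 1 s t.
Proof. by move=> h; exists [:: t]; rewrite /= h. Qed.

Lemma chain_trans k l s t u : chain k s t -> chain l t u -> chain (k + l) s u.
Proof.
move=> [p [pp lp sp]] [q [pq lq sq]]; exists (p ++ q).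
by rewrite cat_path last_cat size_cat lp pp pq lq leq_add.
Qed.

Lemma chain_iter (f : 'I_L.+1 -> site) (i : 'I_L.+1) :
  (forall i j : 'I_L.+1, (j = i.+1 :> nat) -> cost (f i) (f j) <= 1) ->
  chain i (f ord0) (f i) /\ chain i (f i) (f ord0).
Proof.
move=> hf; case: i => i; elim: i => [|i IH] iL.
  by rewrite (_ : Ordinal iL = ord0); [split; exists [::] | apply/val_inj].
have [c1 c2] := IH (ltnW iL).
have h := hf (Ordinal (ltnW iL)) (Ordinal iL) erefl.
split; first by have := chain_trans c1 (chain_step h); rewrite addn1.
by rewrite cost_sym in h; have := chain_trans (chain_step h) c2; rewrite add1n.
Qed.

Definition xhub (x : V) : site := inl (inl (x, ord0)).
Definition yhub (y : V) : site := inl (inr (y, ord0)).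

Lemma chain_edge x y : (M * #|V| <= L)%N -> (0 < M)%N -> adj x y ->
  chain (3 * L) (xhub x) (yhub y).
Proof.
move=> ML M0 axy.
(* The margin [M] on each horizontal segment pays for the two steps of length zero, [cxz] and [czy],
   at the ends of the vertical segment. *)
have rkL (z : V) : (M * enum_rank z + M <= L)%N.
  by apply: leq_trans ML; rewrite -mulnSr leq_mul2l ltn_ord orbT.
have rkL1 (z : V) : (M * enum_rank z < L.+1)%N by have := rkL z; lia.
have unit (i j : 'I_L.+1) : j = i.+1 :> nat -> (i%:Z - j%:Z) ^+ 2 = 1.
  by move=> ->; rewrite intS; ring.
have sub0 (z : int) : (z - z) ^+ 2 = 0 by rewrite subrr expr0n.
pose fx t : site := inl (inl (x, t)).
pose fy t : site := inl (inr (y, t)).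
pose fz t : site := inr (x, y, t).
have stepx (i j : 'I_L.+1) : j = i.+1 :> nat -> cost (fx i) (fx j) <= 1.
  by move=> ij; rewrite costE /= !sub0 unit.
have stepy (i j : 'I_L.+1) : j = i.+1 :> nat -> cost (fy i) (fy j) <= 1.
  by move=> ij; rewrite costE /= !sub0 unit.
have stepz (i j : 'I_L.+1) : j = i.+1 :> nat -> cost (fz i) (fz j) <= 1.
  by move=> ij; rewrite costE /= axy /= !sub0 unit.
have [cx _] := chain_iter (Ordinal (rkL1 y)) stepx.
have [_ cy] := chain_iter (Ordinal (rkL1 x)) stepy.
have [cz _] := chain_iter ord_max stepz.
have cxz : cost (fx (Ordinal (rkL1 y))) (fz ord0) <= 1.
  by rewrite costE /= axy /= !sub0.
have czy : cost (fz ord_max) (fy (Ordinal (rkL1 x))) <= 1.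
  by rewrite costE /= axy /= !sub0.
have [p [pp lp sp]] := chain_trans (chain_trans cx (chain_step cxz))
  (chain_trans (chain_trans cz (chain_step czy)) cy).
exists p; split=> //; apply: leq_trans sp _.
move: (rkL x) (rkL y) M0 => /=.
move: (M * enum_rank x)%N (M * enum_rank y)%N => rx ry; lia.
Qed.

End Sites.

(** * Transport between matrices *)

Lemma frobenius_dist_sqr (R : realType) m n (A B : 'M[R]_(m, n)) :
  frobenius_dist A B ^+ 2 = \sum_i \sum_j (A i j - B i j) ^+ 2.
Proof.
rewrite /frobenius_dist /frobenius_norm sqr_sqrtr.
  by apply: eq_bigr => i _; apply: eq_bigr => j _; rewrite !mxE.
by apply: sumr_ge0 => i _; apply: sumr_ge0 => j _; exact: sqr_ge0.
Qed.

Section OrbitSpaceDist.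
Context (R : realType) (G : finGroupType) (X : Type).
Variables (dX : X -> X -> R) (to : {action G &-> X}).

Definition orbit_point (x : X) : orbit_space to :=
  exist _ (action_orbit to x) (mem_set (imageT (action_orbit to) x)).

Hypothesis dX0 : forall x y, 0 <= dX x y.

Lemma orbit_dist_ge0 o o' : 0 <= orbit_dist dX to o o'.
Proof.
rewrite /orbit_dist; set S := (X in inf X).
have [->|/set0P S0] := eqVneq S set0; first by rewrite inf0.
by apply: lb_le_inf => // _ [p _] [q _] <-.
Qed.

Lemma orbit_dist_ge c x y : (forall g h, c <= dX (to x g) (to y h)) ->
  c <= orbit_dist dX to (orbit_point x) (orbit_point y).
Proof.
move=> hc; apply: lb_le_inf.
  exists (dX (to x 1%g) (to y 1%g)); exists (to x 1%g); first by exists 1%g.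
  by exists (to y 1%g) => //; exists 1%g.
by move=> _ [_ [g _ <-]] [_ [h _ <-]] <-.
Qed.

Lemma orbit_dist_le x y g h :
  orbit_dist dX to (orbit_point x) (orbit_point y) <= dX (to x g) (to y h).
Proof.
apply: ge_inf; first by exists 0 => _ [p _] [q _] <-.
by exists (to x g); [exists g|exists (to y h) => //; exists h].
Qed.

End OrbitSpaceDist.

Section Configurations.
Context (R : realType) (m n : nat) (T : finType) (s0 : T).
Variables (pos : T -> seq int) (K L : int).
Hypotheses (hm : (3 <= m)%N) (Tn : (#|T| < n)%N).
Hypotheses (pos3 : forall s, size (pos s) = 3) (LK : L <= K)
  (posL : forall s i, 0 <= (pos s)`_i <= L).

(* Every site is a column, and [s] is a column once more; the remaining columns
   are equal to [s0]. *)
Definition colsite (s : T) (j : nat) : T := nth s0 (rcons (enum T) s) j.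

Let extra : 'I_n := Ordinal Tn.
Let colof (x : T) : 'I_n := widen_ord (ltnW Tn) (enum_rank x).

Lemma colsite_extra s : colsite s extra = s.
Proof. by rewrite /colsite nth_rcons -cardE ltnn eqxx. Qed.

Lemma colsite_colof s x : colsite s (colof x) = x.
Proof.
by rewrite /colsite nth_rcons -cardE /= ltn_ord nth_enum_rank.
Qed.

Lemma colsite_neq s t (j : 'I_n) : j != extra -> colsite s j = colsite t j.
Proof.
move=> je; rewrite /colsite !nth_rcons -cardE; case: ltnP => // _.
by have /negbTE : (j : nat) != #|T| by []; move=> ->.
Qed.

Lemma extra_colof x : (colof x == extra) = false.
Proof. by apply/negbTE; rewrite -(inj_eq val_inj) /= ltn_eqF. Qed.

(* The shift by [K * i] separates the rows, so that the best row permutation is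
   the identity. *)
Definition entry (s : T) (i j : nat) : int := K * i%:Z + (pos (colsite s j))`_i.

Definition conf (s : T) : 'M[R]_(m, n) := \matrix_(i, j) (entry s i j)%:~R.

(** Rows beyond the third read past the end of [pos] and get the default 0. *)
Lemma sqdistE s t : \sum_(i < m) ((pos s)`_i - (pos t)`_i) ^+ 2 = sqdist (pos s) (pos t).
Proof.
rewrite /sqdist -(subnKC hm) big_split_ord /= [X in _ + X]big1 ?addr0 // => i _.
by rewrite !nth_default ?pos3 ?leq_addr // subrr expr0n.
Qed.

Lemma conf_dist_sqr s t (g h : 'S_m * 'S_n) :
  frobenius_dist (rowcol_act (conf s) g) (rowcol_act (conf t) h) ^+ 2 =
  (\sum_i \sum_j (entry s ((g.1)^-1%g i) ((g.2)^-1%g j)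
                - entry t ((h.1)^-1%g i) ((h.2)^-1%g j)) ^+ 2)%:~R.
Proof.
rewrite frobenius_dist_sqr rmorph_sum; apply: eq_bigr => i _.
rewrite rmorph_sum; apply: eq_bigr => j _.
by rewrite !mxE rmorphXn rmorphB.
Qed.

Lemma conf_dist_ge (phi : T -> int) s t :
  (forall s t, phi s - phi t <= sqdist (pos s) (pos t)) ->
  phi s - phi t <= (K - L) ^+ 2 ->
  (phi s - phi t)%:~R <= orbit_dist (@frobenius_dist R m n) (@rowcol_action R m n)
    (orbit_point _ (conf s)) (orbit_point _ (conf t)) ^+ 2.
Proof.
move=> phiP phiK.
have [hlt|h0] := ltP (phi s - phi t) 0.
  by apply: le_trans (sqr_ge0 _); rewrite lerz0 ltW.
rewrite -[leLHS]sqr_sqrtr ?ler0z // ler_sqr ?nnegrE ?sqrtr_ge0 //; last first.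
  by apply: orbit_dist_ge0 => *; exact: sqrtr_ge0.
apply: orbit_dist_ge => g h; rewrite -ler_sqr ?nnegrE ?sqrtr_ge0 // sqr_sqrtr ?ler0z //.
rewrite [leRHS]conf_dist_sqr ler_int.
(* If the row permutations differ, some row meets a row with another shift, and a single entry there
   already contributes [(K - L) ^+ 2]. *)
have [->|gh] := eqVneq g.1 h.1; last first.
  have [i hi] : exists i, (g.1)^-1%g i != (h.1)^-1%g i.
    apply/existsP; apply: contra_neqT gh => /existsPn hgh; apply: invg_inj.
    by apply/permP => i; have /negPn/eqP := hgh i.
  apply: (le_trans phiK).
  rewrite (bigD1 i) //= (bigD1 extra) //= -addrA.
  apply: ler_wpDr; first apply: addr_ge0; do ?[apply: sumr_ge0 => *]; rewrite ?sqr_ge0 //.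
  rewrite /entry.
  have := posL (colsite s ((g.2)^-1%g extra)) ((g.1)^-1%g i).
  have := posL (colsite t ((h.2)^-1%g extra)) ((h.1)^-1%g i).
  move: ((pos _)`_ _) ((pos _)`_ _) => p q.
  have {hi} : ((g.1)^-1%g i : nat) != (h.1)^-1%g i by rewrite (inj_eq val_inj).
  move: ((g.1)^-1%g i : nat) ((h.1)^-1%g i : nat) => x y hxy hq hp.
  have K0 : 0 <= K by lia.
  have [xy|yx] : (x < y)%N \/ (y < x)%N by lia.
    have hK : K * 1 <= K * (y%:Z - x%:Z) by apply: ler_wpM2l; lia.
    by rewrite -[leRHS]sqrrN opprB ler_sqr ?nnegrE; lia.
  have hK : K * 1 <= K * (x%:Z - y%:Z) by apply: ler_wpM2l; lia.
  by rewrite ler_sqr ?nnegrE; lia.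
rewrite (reindex_inj (@perm_inj _ h.1)) exchange_big /=.
(* Weak duality for transport: the two configurations share all columns but the extra one, so the
   potentials of the shared columns cancel for any matching. *)
apply: (@le_trans _ _ (\sum_j (phi (colsite s ((g.2)^-1%g j)) - phi (colsite t ((h.2)^-1%g j))))).
  have sumcol u (f : 'S_n) : \sum_j phi (colsite u (f j)) = phi u + \sum_(j | j != extra) phi (colsite s j).
    transitivity (\sum_(j < n) phi (colsite u j)).
      by rewrite [RHS](reindex_inj (@perm_inj _ f)).
    rewrite (bigD1 extra) //= colsite_extra; congr (_ + _).
    by apply: eq_bigr => j je; rewrite (colsite_neq u s je).
  by rewrite sumrB !sumcol opprD addrACA subrr addr0.
apply: ler_sum => j _; apply: le_trans (phiP _ _) _; rewrite -sqdistE.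
apply: ler_sum => i _; rewrite permK /entry.
rewrite opprD addrACA subrr add0r //.
Qed.

(** The extra copy of the current site moves into the column of the next site [t], and the old
    occupant of that column becomes the extra copy. As [t] does not recur, the rest of the transport
    fixes its column; the first clause carries this through the induction. *)
Lemma transport_path s (p : seq T) :
  path (fun s t => sqdist (pos s) (pos t) <= 1) s p -> uniq p ->
  exists f : 'S_n, (forall x, x \notin p -> f (colof x) = colof x) /\
   \sum_(j < n) sqdist (pos (colsite s j)) (pos (colsite (last s p) (f j))) <= (size p)%:Z.
Proof.
elim: p s => [|t p IH] s /=.
  move=> _ _; exists 1%g; split=> [x _|]; first by rewrite perm1.
  rewrite big1 // => j _; rewrite perm1 /sqdist big1 // => i _.
  by rewrite subrr expr0n.
case/andP=> st /IH{}IH /andP[tp up]; have [f [fix_f cost_f]] := IH up.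
exists (tperm extra (colof t) * f)%g; split=> [x|].
  rewrite inE negb_or => /andP[xt xp]; rewrite permM tpermD ?fix_f //.
    by rewrite eq_sym extra_colof.
  by rewrite -(inj_eq val_inj) /= (inj_eq val_inj) (inj_eq enum_rank_inj) eq_sym.
rewrite intS; apply: (le_trans _ (lerD st cost_f)).
rewrite (bigD1 extra) // (bigD1 (colof t)) ?extra_colof //=.
rewrite [X in _ <= _ + X](bigD1 extra) // (bigD1 (colof t)) ?extra_colof //=.
rewrite !permM tpermL tpermR fix_f // !colsite_extra !colsite_colof.
have -> : sqdist (pos t) (pos t) = 0.
  by rewrite /sqdist big1 // => i _; rewrite subrr expr0n.
rewrite add0r addrA; set rest := \sum_(_ < _ | _) _; set rest' := \sum_(_ < _ | _) _.
suff -> : rest = rest' by rewrite addrA.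
apply: eq_bigr => j /andP[je jt].
by rewrite permM tpermD 1?eq_sym // (colsite_neq s t je).
Qed.

Lemma conf_dist_le s t (p : seq T) :
  path (fun s t => sqdist (pos s) (pos t) <= 1) s p -> last s p = t ->
  orbit_dist (@frobenius_dist R m n) (@rowcol_action R m n)
    (orbit_point _ (conf s)) (orbit_point _ (conf t)) ^+ 2 <= (size p)%:R.
Proof.
move=> pp <-; case/shortenP: (pp) => q pq /andP[_ uq] qp.
have [f [_ cost_f]] := transport_path pq uq.
apply: (@le_trans _ _ (size q)%:R); last by rewrite ler_nat uniq_leq_size.
have le_d : orbit_dist (@frobenius_dist R m n) (@rowcol_action R m n)
    (orbit_point _ (conf s)) (orbit_point _ (conf (last s q))) <=
    frobenius_dist (rowcol_act (conf s) 1%g) (rowcol_act (conf (last s q)) (1%g, f^-1%g)).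
  by apply: orbit_dist_le => *; exact: sqrtr_ge0.
apply: (@le_trans _ _ (frobenius_dist (rowcol_act (conf s) 1%g)
    (rowcol_act (conf (last s q)) (1%g, f^-1%g)) ^+ 2)).
  rewrite ler_sqr ?nnegrE ?sqrtr_ge0 //.
  by apply: orbit_dist_ge0 => *; exact: sqrtr_ge0.
rewrite conf_dist_sqr /= -[leRHS]/((size q)%:Z%:~R) ler_int.
apply: le_trans cost_f; rewrite exchange_big /=.
apply: ler_sum => j _; rewrite -sqdistE; apply: ler_sum => i _.
by rewrite !invg1 !perm1 invgK /entry opprD addrACA subrr add0r.
Qed.

End Configurations.

(** * Distortion *)

Lemma mxrank_triangle (F : fieldType) p q (x y z : 'M[F]_(p, q)) : (\rank (y - x)%R <= 1)%N ->
  (\rank (x - z)%R <= (\rank (y - z)%R).+1)%N.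
Proof.
move=> xy; have -> : x - z = (y - z) - (y - x) by rewrite opprB [RHS]addrC addrA subrK.
by apply: leq_trans (mxrank_add _ _) _; rewrite mxrank_opp -addn1 leq_add2l.
Qed.

Section Embedding.
Context (R : realType) (m n a : nat).
Local Notation V := 'M['F_2]_a.
(** These sizes make the drawing fit, [M * #|V| = L], and meet the separation needed in [rk_far]
    with equality, [a * L = M * M]. *)
Let M := (a * #|{: V}|)%N.
Let L := (M * #|{: V}|)%N.
Let adj (x y : V) := (\rank (y - x)%R <= 1)%N.
Local Notation T := (site V L).
Local Notation dist := (orbit_dist (@frobenius_dist R m n) (@rowcol_action R m n)).
Hypotheses (hm : (3 <= m)%N) (a0 : (0 < a)%N) (Tn : (#|{: T}| < n)%N).

(** The row shift [L + a * L] makes a wrong row permutation cost at least [(a * L) ^+ 2], which is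
    no less than the range of the potential. *)
Let pt (s : T) : orbit_space (@rowcol_action R m n) :=
  orbit_point _ (conf R m n (xhub L (0 : V)) (pos adj M (L:=L)) (L + a * L)%N s).

(** [F] and [G] are the two sheets of the double cover. The case [x = y] of the first bound links
    the two copies of a vertex. *)
Lemma bilinear_forms_graph_embedding :
  exists F G : V -> orbit_space (@rowcol_action R m n),
   (forall x y, (\rank (y - x)%R <= 1)%N -> dist (F x) (G y) ^+ 2 <= (3 * L)%:R) /\
   (forall x, (a * L)%:R <= dist (F (x + 1%:M)) (F x) ^+ 2).
Proof.
have N0 : (0 < #|{: V}|)%N by apply/card_gt0P; exists 0.
have aL : (a <= L)%N by rewrite /L /M -mulnA leq_pmulr // muln_gt0 N0.
have M0 : (0 < M)%N by rewrite muln_gt0 a0.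
have pos3 (s : T) : size (pos adj M s) = 3 by case: s => [[[]|[]]|[[]]].
exists (fun x => pt (xhub L x)), (fun y => pt (yhub L y)); split=> [x y xy|x].
  have [p [pp lp sp]] := chain_edge (leqnn L) M0 (xy : adj x y).
  by apply: le_trans (conf_dist_le _ _ _ hm Tn pos3 pp lp) _; rewrite ler_nat.
(* The potential built on the rank distance to [x] vanishes at [x] and reaches its maximum [a * L]
   at [x + 1%:M]. *)
pose d (y : V) := \rank (y - x)%R.
have da y : (d y <= a)%N by exact: rank_leq_row.
have dadj y z : adj y z -> (d y <= (d z).+1)%N && (d z <= (d y).+1)%N.
  move=> yz; rewrite !mxrank_triangle //.
  by rewrite -mxrank_opp opprB.
have aLM : (a * L <= M * M)%N by rewrite /L /M; lia.
pose phi := potential adj d (L := L).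
have phix : phi (xhub L x) = 0 by rewrite /phi /= /d subrr mxrank0 mulr0.
have phix1 : phi (xhub L (x + 1%:M)) = (a * L)%N.
  by rewrite /phi /= /d addrC addKr mxrank1 mulnC PoszM.
have := @conf_dist_ge R m n T (xhub L 0) (pos adj M (L:=L)) (L + a * L)%N L hm Tn pos3 _ _ phi
  (xhub L (x + 1%:M)) (xhub L x).
rewrite phix phix1 subr0; apply=> [|s i|s t|].
- by rewrite lez_nat leq_addr.
- by apply: pos_bounds.
- rewrite -/(cost adj M s t) cost_sym; exact: potential_le.
- by rewrite PoszD addrAC subrr add0r; nia.
Qed.

End Embedding.

(** Reduction to real constants: a pair at positive distance excludes [+oo] as a lower constant, and
    the degenerate cases have distortion [+oo]. *)
Lemma distortion_ge (R : realType) (X : Type) (dX : X -> X -> R)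
    (H : normedModType R) (f : X -> H) (k : R) :
  (exists x y, 0 < dX x y) -> 0 < k ->
  (forall alpha beta, 0 <= alpha -> 0 <= beta ->
    (forall x y, alpha * dX x y <= `|f x - f y|) ->
    (forall x y, `|f x - f y| <= beta * dX x y) -> k * alpha <= beta) ->
  (k%:E <= distortion dX (@norm_dist R H) f)%E.
Proof.
move=> [x0 [y0 d0]] k0 hk; rewrite /distortion.
case: ifPn => [_|]; first exact: leey.
rewrite negb_or => /andP[]; set lo := lower_lipschitz _ _ _; set up := upper_lipschitz _ _ _.
move=> lo0 upoo.
have lo_gt0 : (0 < lo)%E.
  rewrite lt0e lo0; apply: ereal_sup_ubound; split=> // x y.
  by rewrite mul0e lee_fin normr_ge0.
have lo_le (b : R) : (0 <= b%:E)%E ->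
    (forall x y, ((norm_dist (f x) (f y))%:E <= b%:E * (dX x y)%:E)%E) ->
    (lo <= (k^-1 * b)%:E)%E.
  move=> b0 hb; apply: ge_ereal_sup => -[al| |] // [al0 hal].
    by rewrite lee_fin ler_pdivlMl // hk.
    by have := hal x0 y0; rewrite gt0_mulye ?lte_fin // leye_eq.
  exact: leNye.
have : (up < +oo)%E by rewrite ltey.
case/ereal_inf_lt => y [y0' hy]; case: y y0' hy => [c| |] // c0 hc _.
have := le_lt_trans (lo_le c c0 hc) (ltry _).
move: lo lo_gt0 lo_le {lo0} => [r| |] //; rewrite lte_fin => r0 lo_le _.
rewrite inver gt_eqF // lee_pdivlMr // -EFinM.
apply: le_ereal_inf_tmp => -[z| |] [z0 hz]; [|exact: leey|by []].
by have := lo_le z z0 hz; rewrite !lee_fin ler_pdivlMl.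
Qed.

Theorem theorem32 (R : realType) (m : nat) (hm : (3 <= m)%N) :
  limn_einf (fun n : nat =>
    euclidean_distortion
      (orbit_dist (@frobenius_dist R m n) (@rowcol_action R m n))) = +oo%E.
Proof.
have ge_k (k : nat) : exists N, forall n, (N < n)%N ->
   (k.+1%:R%:E <= euclidean_distortion
      (orbit_dist (@frobenius_dist R m n) (@rowcol_action R m n)))%E.
  (* 48 is the Poincaré constant 4 times the edge constant 12 below. *)
  pose a := (48 * k.+1 ^ 2)%N.
  exists #|{: site 'M['F_2]_a (a * #|{: 'M['F_2]_a}| * #|{: 'M['F_2]_a}|)}| => n Nn.
  apply: le_ereal_inf_tmp => _ [H [f <-]].
  have [F [G [hFG hF]]] :=
    bilinear_forms_graph_embedding R hm (isT : (0 < a)%N) Nn.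
  set L := (a * _ * _)%N in hFG hF; set V := 'M['F_2]_a in F G hFG hF.
  have d0 o o' : 0 <= orbit_dist (@frobenius_dist R m n) (@rowcol_action R m n) o o'.
    by apply: orbit_dist_ge0 => *; exact: sqrtr_ge0.
  set dist := orbit_dist _ _ in hFG hF d0 *.
  have L0 : (0 < L)%N.
    by rewrite !muln_gt0 /=; apply/andP; split; apply/card_gt0P; exists 0.
  apply: distortion_ge => //.
    exists (F (0 + 1%:M)), (F 0); rewrite lt_neqAle d0 andbT eq_sym.
    have := hF 0; apply: contraTneq => ->.
    by rewrite expr0n /= -ltNge ltr0n muln_gt0.
  move=> al be al0 be0 hal hbe.
  (* Adjacent vertices of one sheet are joined through [G Y]: two distances of square at most
     [3 * L] have a sum of square at most [12 * L]. *)
  have edge X Y : (\rank (Y - X)%R <= 1)%N -> `|f (F Y) - f (F X)| ^+ 2 <= 12 * L%:R * be ^+ 2.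
    move=> XY.
    have YY : (\rank (Y - Y)%R <= 1)%N by rewrite subrr mxrank0.
    have e1 := hbe (F Y) (G Y); have e2 := hbe (F X) (G Y).
    have tri : `|f (F Y) - f (F X)| <= be * (dist (F Y) (G Y) + dist (F X) (G Y)).
      apply: le_trans (ler_distD (f (G Y)) _ _) _.
      by rewrite [X in _ + X]distrC mulrDr lerD.
    apply: (@le_trans _ _ ((be * (dist (F Y) (G Y) + dist (F X) (G Y))) ^+ 2)).
      by rewrite ler_sqr ?nnegrE // mulr_ge0 // addr_ge0.
    rewrite exprMn mulrC ler_wpM2r ?sqr_ge0 //.
    have := hFG _ _ YY; have := hFG _ _ XY; rewrite natrM; nra.
  have up := poincare 1%:M edge.
  have lo : #|{: V}|%:R * (al ^+ 2 * (a * L)%:R) <= \sum_(X : V) `|f (F (X + 1%:M)) - f (F X)| ^+ 2.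
    rewrite mulr_natl -sumr_const; apply: ler_sum => X _.
    apply: (@le_trans _ _ ((al * dist (F (X + 1%:M)) (F X)) ^+ 2)).
      by rewrite exprMn ler_wpM2l ?sqr_ge0.
    by rewrite ler_sqr ?nnegrE // mulr_ge0.
  have N0 : 0 < #|{: V}|%:R :> R by rewrite ltr0n; apply/card_gt0P; exists 0.
  have {up lo} := le_trans lo up.
  rewrite [leRHS]mulrCA ler_pM2l // natrM.
  have LR : 0 < L%:R :> R by rewrite ltr0n.
  have -> : 4 * (12 * L%:R * be ^+ 2) = L%:R * (48 * be ^+ 2) by ring.
  rewrite [X in X <= _](_ : _ = L%:R * (48 * (k.+1%:R * al) ^+ 2)); last first.
    by rewrite /a natrM natrX; ring.
  rewrite !ler_pM2l // ler_sqr ?nnegrE ?mulr_ge0 //.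
have cvg_oo : ((fun n : nat => euclidean_distortion
    (orbit_dist (@frobenius_dist R m n) (@rowcol_action R m n))) @ \oo --> +oo%E)%classic.
  apply/cvgeyPge => A; have [N hN] := ge_k (Num.truncn `|A|).
  exists N.+1 => // n Nn; apply: le_trans (hN n Nn).
  by rewrite lee_fin (le_trans (ler_norm A)) // ltW // truncnS_gt.
by have [-> _] := cvg_limn_einf_sup cvg_oo.
Qed.
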